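(* Let $q=p^m$ be a prime power and let $\mathbb{F}_q$ be the finite field with $q$ elements. Let $A\subset\mathbb{F}_q$ and $B\subset\mathbb{F}_q$ be such that $B$ is antisymmetric, i.e. $B\cap(-B)=\emptyset$, and $|A||B|>q$. Then $8AB=\mathbb{F}_q$.
   Context: For $X,Y\subset\mathbb{F}_q$, $XY=\{xy: x\in X, y\in Y\}$, and for a natural number $k$, $kX=\{x_1+\dots+x_k: x_1,\dots,x_k\in X\}$; thus $8AB$ is the set of all sums of $8$ elements of $AB$. Also $-B=\{-b:b\in B\}$. *)

(* Defs.v *)
From HB Require Import structures.
From mathcomp Require Import all_boot all_order all_algebra.

Set Implicit Arguments.
Unset Strict Implicit.
Unset Printing Implicit Defensive.

Import GRing.Theory.
Local Open Scope ring_scope.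

Definition mulset (F : finFieldType) (X Y : {set F}) : {set F} :=
  [set x * y | x in X, y in Y].

(* The k-fold sumset: the summands need not be distinct. *)
Definition sumset (F : finFieldType) (k : nat) (X : {set F}) : {set F} :=
  [set \sum_(i < k) x i | x : {ffun 'I_k -> F} & [forall i, x i \in X]].

Definition oppset (F : finFieldType) (X : {set F}) : {set F} :=
  [set - x | x in X].

Definition antisymmetric_set (F : finFieldType) (X : {set F}) : Prop :=
  X :&: oppset X = set0.

(* Main.v *)
Require Import Defs.
From HB Require Import structures.
From mathcomp Require Import all_boot all_order all_algebra.
From mathcomp Require Import zify ring.

(** Averaging the number of collisions [a + t * b = a' + t * b'] over all [t]
    gives, by Cauchy-Schwarz, a [t] for which [A + t B] fills more than half of
    the field; exchanging [b] and [b'] shows that so does [A - t B]. A set filling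
    more than half of the field has every element as a sum of two of its members;
    in particular [0 = (a1 + t * b1) + (a2 + t * b2)]. As [B] is antisymmetric,
    [b1 + b2] is nonzero, so dilating [A - t B] by it gives
    [(b1 + b2) A + (a1 + a2) B], which is contained in [4AB] and fills more than
    half of the field. Hence [8AB] is the whole field. *)

Set Implicit Arguments.
Unset Strict Implicit.
Unset Printing Implicit Defensive.

Import GRing.Theory.
Local Open Scope ring_scope.

Section Collisions.

Variables (U T : finType).

Definition collisions (P : {set U}) (f : U -> T) : {set U * U} :=
  [set w in setX P P | f w.1 == f w.2].

(** Colliding pairs lie in a common fibre of [f], and a fibre of size [r] contributes [r ^ 2] of
    them. *)
Lemma card_collisions (P : {set U}) (f : U -> T) :
  #|collisions P f| =
  (\sum_(y in f @: P) #|[set u in P | f u == y]| ^ 2)%N.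
Proof.
rewrite -sum1_card (partition_big (fun w => f w.1) (mem (f @: P))) /=; last first.
  by move=> [u v]; rewrite !inE /= => /andP[/andP[uP _] _]; apply: imset_f.
apply: eq_bigr => y _; rewrite -mulnn -cardsX -sum1_card.
apply: eq_bigl => -[u v]; rewrite !inE /=.
by apply/idP/idP => [/andP[/andP[/andP[-> ->] /eqP <-] /eqP ->] | /andP[/andP[-> /eqP ->] /andP[-> /eqP ->]]];
  rewrite !eqxx.
Qed.

Lemma sqr_sum_leq (I : finType) (D : {set I}) (r : I -> nat) :
  ((\sum_(i in D) r i) ^ 2 <= #|D| * \sum_(i in D) r i ^ 2)%N.
Proof.
(* After doubling, [2 * (r i * r j) <= r i ^ 2 + r j ^ 2] applies term by term. *)
rewrite -(leq_pmul2l (isT : 0 < 2)%N) -mulnn big_distrlr /=.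
have -> : (2 * (#|D| * \sum_(i in D) r i ^ 2) =
    \sum_(i in D) \sum_(j in D) (r i ^ 2 + r j ^ 2))%N.
  under [RHS]eq_bigr => i _ do rewrite big_split /= sum_nat_const.
  by rewrite big_split /= sum_nat_const -big_distrr /= mul2n addnn.
rewrite big_distrr /=; apply: leq_sum => i _.
by rewrite big_distrr /=; apply: leq_sum => j _; apply: nat_Cauchy.
Qed.

Lemma sqr_card_leq_collisions (P : {set U}) (f : U -> T) :
  (#|P| ^ 2 <= #|f @: P| * #|collisions P f|)%N.
Proof.
rewrite card_collisions.
suff -> : #|P| = (\sum_(y in f @: P) #|[set u in P | f u == y]|)%N.
  exact: sqr_sum_leq.
rewrite -sum1_card (partition_big f (mem (f @: P))) /=; last first.
  by move=> u; apply: imset_f.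
apply: eq_bigr => y _; rewrite -sum1_card.
by apply: eq_bigl => u; rewrite inE.
Qed.

End Collisions.

Section Lines.

Variable F : finFieldType.
Implicit Types (A B X Y : {set F}) (t c : F).

Definition line t (u : F * F) : F := u.1 + t * u.2.

Lemma line_imsetP A B t y :
  reflect (exists a b, [/\ a \in A, b \in B & y = a + t * b])
          (y \in line t @: setX A B).
Proof.
apply: (iffP imsetP) => [[[a b]]|[a [b [aA bB ->]]]].
  by rewrite inE /= => /andP[aA bB] ->; exists a, b.
by exists (a, b); rewrite // inE /= aA.
Qed.

(** Exchanging the sums, a diagonal pair collides for every [t] and any other pair for at most one
    [t]. Bounding the number of other pairs by that of all pairs is affordable. *)
Lemma sum_collisions_line A B :
  (\sum_t #|collisions (setX A B) (line t)|
   <= #|F| * (#|A| * #|B|) + (#|A| * #|B|) ^ 2)%N.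
Proof.
rewrite -cardsX; set P := setX A B.
have -> : (\sum_t #|collisions P (line t)| =
    \sum_(w in setX P P) #|[set t | line t w.1 == line t w.2]|)%N.
  under eq_bigr => t _ do rewrite -sum1_card big_mkcond /=.
  rewrite exchange_big [RHS]big_mkcond /=; apply: eq_bigr => w _.
  case: ifP => wP; last by rewrite big1 // => t _; rewrite inE wP.
  rewrite -sum1_card [RHS]big_mkcond /=; apply: eq_bigr => t _.
  by rewrite !inE -in_setX; move: wP; rewrite !inE => ->.
have inner (w : (F * F) * (F * F)) :
    (#|[set t | line t w.1 == line t w.2]| <= #|F| * (w.1 == w.2) + 1)%N.
  case: eqP => [_|/eqP neq]; first by rewrite muln1 (leq_trans (max_card _)) ?leq_addr.
  rewrite muln0; apply/card_le1_eqP => s t; rewrite !inE => /eqP es /eqP et.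
  case: w es et neq => [[a b] [a' b']]; rewrite /line /= => es et.
  (* If [b != b'], subtracting the two collision equations gives [s = t]; if [b = b'], then also
     [a = a'], against [neq]. *)
  case: (eqVneq b b') => [eb|nb]; last first.
    move=> _; suff /eqP : (s - t) * (b - b') = 0.
      by rewrite mulf_eq0 !subr_eq0 (negPf nb) orbF => /eqP.
    have -> : (s - t) * (b - b') = (a + s * b) - (a' + s * b') - ((a + t * b) - (a' + t * b')).
      by ring.
    by rewrite es et !subrr.
  by move: es; rewrite eb => /addIr ->; rewrite eqxx.
apply: (leq_trans (leq_sum _ (fun w _ => inner w))).
rewrite big_split /= sum1_card cardsX mulnn leq_add2r -big_distrr /= leq_mul2l.
apply/orP; right; rewrite -(card_imset P (f := fun u => (u, u))); last by move=> u v [].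
rewrite -sum1_card big_mkcond [leqRHS]big_mkcond /=; apply: leq_sum => -[u v] _ /=.
rewrite in_setX; case: ifP => // /andP[uP _]; case: eqP => // <-.
by rewrite imset_f.
Qed.

(** The equation [a - t * b = a' - t * b'] amounts to [a + t * b' = a' + t * b], so swapping [b] and
    [b'] injects one set of collisions into the other. *)
Lemma card_collisions_lineN A B t :
  (#|collisions (setX A B) (line (- t))| <= #|collisions (setX A B) (line t)|)%N.
Proof.
pose s (w : (F * F) * (F * F)) := ((w.1.1, w.2.2), (w.2.1, w.1.2)).
have sK : involutive s by case=> [[? ?] [? ?]].
rewrite -(card_imset _ (inv_inj sK)); apply: subset_leq_card.
apply/subsetP => _ /imsetP[[[a b] [a' b']] + ->].
rewrite !inE /line /= => /andP[/andP[/andP[-> ->] /andP[-> ->]] /eqP e] /=.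
apply/eqP; have -> : a + t * b' = a + - t * b + t * b + t * b' by ring.
by rewrite e; ring.
Qed.

Lemma exists_large_lines A B : (#|F| < #|A| * #|B|)%N ->
  exists t, (#|F| < 2 * #|line t @: setX A B|)%N /\
            (#|F| < 2 * #|line (- t) @: setX A B|)%N.
Proof.
set n := (#|A| * #|B|)%N => ltn.
have large s : (#|F| * #|collisions (setX A B) (line s)| < 2 * n ^ 2)%N ->
    (#|F| < 2 * #|line s @: setX A B|)%N.
  have := sqr_card_leq_collisions (setX A B) (line s); rewrite cardsX -/n.
  set S := #|_ @: _|; set E := #|_| => le_n2 lt_E; rewrite ltnNge; apply/negP => leS.
  (* If [2 * S <= #|F|], then [2 * n ^ 2 <= 2 * S * E <= #|F| * E], a contradiction. *)
  have := leq_mul leS (leqnn E); lia.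
have [t lt_t] : exists t, (#|F| * #|collisions (setX A B) (line t)| < 2 * n ^ 2)%N.
  apply/existsP; apply: contraT => /existsPn ge.
  have := sum_collisions_line A B; rewrite -/n => le.
  have : (#|F| * (2 * n ^ 2) <= \sum_t #|F| * #|collisions (setX A B) (line t)|)%N.
    by rewrite -sum_nat_const; apply: leq_sum => t _; rewrite leqNgt ge.
  have F_gt0 : (0 < #|F|)%N by apply/card_gt0P; exists 0.
  (* This yields [2 * n ^ 2 <= #|F| * n + n ^ 2], hence [n <= #|F|], against [ltn]. *)
  rewrite -big_distrr /= leq_pmul2l // => /leq_trans/(_ le).
  by rewrite mul2n -addnn leq_add2r -mulnn leq_pmul2r ?(ltn_trans F_gt0) // leqNgt ltn.
exists t; split; apply: large => //; apply: leq_ltn_trans lt_t.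
by rewrite leq_mul2l card_collisions_lineN orbT.
Qed.

(** By pigeonhole, [X] and its reflection [c - X], of equal size, must meet. *)
Lemma large_set_add X c : (#|F| < 2 * #|X|)%N ->
  exists x y, [/\ x \in X, y \in X & c = x + y].
Proof.
move=> ltX; have inj : injective (fun x => c - x) by move=> x y /addrI/oppr_inj.
have : X :&: [set c - x | x in X] != set0.
  rewrite -card_gt0 lt0n; apply: contraTneq ltX => I0.
  rewrite -leqNgt mul2n -addnn -{2}(card_imset X inj) -cardsUI I0 addn0.
  exact: max_card.
case/set0Pn => x /setIP[xX /imsetP[y yX xE]].
by exists x, y; split=> //; rewrite xE subrK.
Qed.

Lemma mem_sumset X (s : seq F) :
  all (fun x => x \in X) s -> \sum_(x <- s) x \in sumset (size s) X.
Proof.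
move=> /allP sX; apply/imsetP; exists [ffun i : 'I_(size s) => s`_i].
  by rewrite inE; apply/forallP => i; rewrite ffunE sX ?mem_nth.
by rewrite (big_nth 0) big_mkord; apply: eq_bigr => i _; rewrite ffunE.
Qed.

End Lines.

Theorem theorem7 (p m q : nat) (p_prime : prime p) (m_gt0 : (0 < m)%N)
    (q_def : q = (p ^ m)%N) (F : finFieldType) (cardF : #|F| = q)
    (A B : {set F}) (B_antisym : antisymmetric_set B)
    (cardAB : (q < #|A| * #|B|)%N) :
  sumset 8 (mulset A B) = [set: F].
Proof.
move: cardAB; rewrite -cardF => /exists_large_lines[t [large_t large_Nt]].
have [_ [_ [/line_imsetP[a1 [b1 [a1A b1B ->]]] /line_imsetP[a2 [b2 [a2A b2B ->]]] e0]]] :=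
  large_set_add 0 large_t.
have nz : b1 + b2 != 0.
  (* Otherwise [b1 = - b2] would lie in both [B] and [- B]. *)
  apply: contraTneq b1B => /eqP; rewrite addr_eq0 => /eqP b1E.
  by have /setP/(_ b1) := B_antisym; rewrite !inE {2}b1E imset_f // andbT => ->.
have tE : - t * (b1 + b2) = a1 + a2.
  by rewrite -[RHS]subr0 e0; ring.
apply/setP => c; rewrite inE.
have [_ [_ [/line_imsetP[a [b [aA bB ->]]] /line_imsetP[a' [b' [a'A b'B ->]]] ec]]] :=
  large_set_add (c / (b1 + b2)) large_Nt.
(* Multiplying [ec] by [b1 + b2] and replacing [- t * (b1 + b2)] by [a1 + a2] leaves exactly eight
   products. *)
have -> : c = \sum_(x <- [:: a * b1; a * b2; a1 * b; a2 * b;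
                             a' * b1; a' * b2; a1 * b'; a2 * b']) x.
  rewrite !big_cons big_nil -(divfK nz c) ec.
  transitivity ((a + a') * (b1 + b2) + (- t * (b1 + b2)) * (b + b')); first by ring.
  by rewrite tE; ring.
have AB x y : x \in A -> y \in B -> x * y \in mulset A B by apply: imset2_f.
by apply: mem_sumset; rewrite /= !AB.
Qed.
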